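(* Let $q\in(0,1)$, $n\ge1$ and $b<0$. Then the $q$-Bessel polynomial satisfies $$B_n(x;b|q)\in\mathbb{P}_n^q((0,1)).$$ If additionally $q^2<t<1$, then $$B_n(x;b|q)\preccurlyeq B_n(x;tb|q).$$
   Context: For $c\in\mathbb{C}$ and an integer $j\ge0$, $(c;q)_0:=1$ and $(c;q)_j:=\prod_{i=0}^{j-1}(1-cq^i)$. The little $q$-Jacobi polynomial is $$p_n(x;a,b|q):=\sum_{j=0}^n\frac{(q^{-n};q)_j\,(abq^{n+1};q)_j}{(aq;q)_j\,(q;q)_j}\,(qx)^j ,$$ and the $q$-Bessel polynomial of degree $n$ with parameter $b<0$ is its limit $$B_n(x;b|q):=\lim_{a\to0}p_n\left(x;a,\tfrac{b}{qa}\,\middle|\,q\right)=\sum_{j=0}^n\frac{(q^{-n};q)_j\,(bq^{n};q)_j}{(q;q)_j}\,(qx)^j .$$ For a polynomial $p$ of degree $n\ge2$ with positive zeros $\lambda_1(p)\le\dots\le\lambda_n(p)$ (with multiplicity), its logarithmic mesh is $\operatorname{lmesh}(p):=\max_{1\le j\le n-1}\lambda_j(p)/\lambda_{j+1}(p)$. For $K\subset(0,\infty)$, $\mathbb{P}_n^q(K)$ is the set of polynomials of degree $n$ with all zeros in $K$ and with $\operatorname{lmesh}(p)<q$ (for $n=1$ the condition on the logarithmic mesh is vacuous). For real-rooted polynomials $p,r$ of the same degree $n$, $p\preccurlyeq r$ means $\lambda_1(p)\le\lambda_1(r)\le\lambda_2(p)\le\lambda_2(r)\le\dots\le\lambda_n(p)\le\lambda_n(r)$.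 *)

(* Defs.v *)
From HB Require Import structures.
From mathcomp Require Import all_boot all_order all_algebra ring.
From mathcomp Require Import polyrcf complex.
From mathcomp Require Import all_classical all_reals all_analysis.

Set Implicit Arguments.
Unset Strict Implicit.
Unset Printing Implicit Defensive.

Import Order.TTheory GRing.Theory Num.Theory.
Import numFieldNormedType.Exports.

Local Open Scope classical_set_scope.
Local Open Scope ring_scope.

Definition qpoch (R : realType) (c q : R) (j : nat) : R :=
  \prod_(i < j) (1 - c * q ^+ i).

Definition little_q_jacobi (R : realType) (n : nat) (a b q : R) : {poly R} :=
  \sum_(j < n.+1)
    (qpoch (q ^- n) q j * qpoch (a * b * q ^+ n.+1) q j
      / (qpoch (a * q) q j * qpoch q q j)) *: (q *: 'X) ^+ j.

Definition q_bessel (R : realType) (n : nat) (b q : R) : {poly R} :=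
  \sum_(j < n.+1)
    (qpoch (q ^- n) q j * qpoch (b * q ^+ n) q j / qpoch q q j)
      *: (q *: 'X) ^+ j.

(* q_bessel is the limit of little q-Jacobi polynomials by which
   q-Bessel polynomials are introduced *)
Lemma q_bessel_limit (R : realType) (n : nat) (b q x : R) : q != 0 ->
  (little_q_jacobi n a (b / (q * a)) q).[x] @[a --> 0^'] --> (q_bessel n b q).[x].
Proof.
move=> q0.
pose F (a : R) : R := \sum_(j < n.+1)
  (qpoch (q ^- n) q j * qpoch (b * q ^+ n) q j
    * (qpoch (a * q) q j * qpoch q q j)^-1) * ((q *: 'X) ^+ j).[x].
have poch0 j : qpoch (0 * q) q j = 1.
  by rewrite /qpoch big1// => i _; rewrite !mul0r subr0.
have -> : (q_bessel n b q).[x] = F 0.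
  rewrite /q_bessel /F horner_sum; apply: eq_bigr => j _.
  by rewrite hornerZ poch0 mul1r.
have FE : \forall a \near (0 : R)^',
    F a = (little_q_jacobi n a (b / (q * a)) q).[x].
  near=> a.
  have a0 : a != 0 by near: a; exact: nbhs_dnbhs_neq.
  rewrite /little_q_jacobi /F horner_sum; apply: eq_bigr => j _.
  rewrite hornerZ; congr (_ * qpoch _ q j / _ * _).
  by rewrite invfM exprS; field; rewrite a0 q0.
apply: (cvg_trans (near_eq_cvg FE)); apply: cvg_within_filter.
rewrite /F; apply: cvg_big => [|j _]; first exact: add_continuous.
apply: cvgM; last exact: cvg_cst.
apply: cvgM; first exact: cvg_cst.
under eq_fun do rewrite invfM.
rewrite invfM.
apply: cvgM; last exact: cvg_cst.
apply: cvgV; first by rewrite poch0 oner_neq0.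
rewrite /qpoch; apply: cvg_big => [|i _]; first exact: mul_continuous.
apply: cvgB; first exact: cvg_cst.
apply: cvgM; last exact: cvg_cst.
by apply: cvgM; [exact: cvg_id | exact: cvg_cst].
Unshelve. all: by end_near.
Qed.

(* rootsR p lists the distinct real roots of p in increasing order *)
Definition real_zeros (R : realType) (p : {poly R}) : seq R :=
  flatten [seq nseq (mup x p) x | x <- rootsR p].

Lemma real_zeros_prodXsubC (R : realType) (c : R) (s : seq R) :
  c != 0 -> sorted <=%R s ->
  real_zeros (c *: \prod_(z <- s) ('X - z%:P)) = s.
Proof.
move=> c0 ss; set P := \prod_(z <- s) _; set p := c *: P.
have P0 : P != 0 by rewrite monic_neq0// monic_prod_XsubC.
have p0 : p != 0 by rewrite scaler_eq0 negb_or c0.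
have mupE x : mup x p = count_mem x s.
  by rewrite /p -mul_polyC mupMr ?mu_prod_XsubC// rootC.
have rsort : sorted <%R (rootsR p) by rewrite /rootsR; case: rootsP.
have mem_rootsR x : (x \in rootsR p) = (x \in s).
  by rewrite -(roots_on_rootsR p0) in_itv/= /p rootZ// root_prod_XsubC.
apply: (le_sorted_eq _ ss).
  rewrite /real_zeros sorted_pairwise; last exact: le_trans.
  have : pairwise <%R (rootsR p).
    by rewrite -sorted_pairwise//; exact: lt_trans.
  elim: (rootsR p) => //= a r IH /andP[ar /IH rr].
  rewrite pairwise_cat rr andbT; apply/andP; split.
    apply/allrelP => u v /nseqP[-> _] /flatten_mapP[w wr /nseqP[-> _]].
    exact/ltW/(allP ar).
  by elim: (mup a p) => //= m ->; rewrite andbT; apply/allP => u /nseqP[-> _].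
apply/allP => x _ /=; apply/eqP.
rewrite /real_zeros count_flatten -map_comp.
under eq_map => a do rewrite /= count_nseq mupE.
have [xs|xs] := boolP (x \in s); last first.
  rewrite (count_memPn xs) sumnE big_map big1_seq// => a /andP[_].
  rewrite mem_rootsR => as_; have /negPf ax : a != x.
    by apply: contraNneq xs => <-.
  by rewrite /= ax.
rewrite sumnE big_map (bigD1_seq x)/= ?mem_rootsR//; last first.
  exact: (sorted_uniq lt_trans lt_irreflexive).
by rewrite eqxx mul1n big1 ?addn0// => a /negPf /= ->.
Qed.

(* the j-th smallest zero, with multiplicity, for 1 <= j <= deg p *)
Definition lambda (R : realType) (p : {poly R}) (j : nat) : R :=
  (real_zeros p)`_j.-1.

Definition zeros_in (R : realType) (K : set R) (p : {poly R}) : Prop :=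
  forall z : R[i], root (map_poly (real_complex R) p) z ->
    exists2 x : R, K x & z = real_complex R x.

Definition real_rooted (R : realType) (p : {poly R}) : Prop :=
  p != 0 /\ zeros_in setT p.

(* the zeros are meant to be positive, so that 0 is neutral for the maximum *)
Definition lmesh (R : realType) (p : {poly R}) : R :=
  \big[Num.max/0]_(1 <= j < (size p).-1) (lambda p j / lambda p j.+1).

Definition polys_lmesh (R : realType) (n : nat) (q : R) (K : set R) :
    set {poly R} :=
  [set p : {poly R} | [/\ size p = n.+1, zeros_in K p & (2 <= n)%N -> lmesh p < q]].

Definition preceq (R : realType) (p r : {poly R}) : Prop :=
  [/\ real_rooted p, real_rooted r, size p = size r,
      forall j, (1 <= j <= (size p).-1)%N -> lambda p j <= lambda r j &
      forall j, (1 <= j < (size p).-1)%N -> lambda r j <= lambda p j.+1].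

(* Main.v *)
Require Import Defs.
From mathcomp Require Import all_boot all_order all_algebra.
From mathcomp Require Import all_classical all_reals all_analysis.
From mathcomp Require Import polyrcf complex ring lra zify.

(** Why the theorem holds.  Put B = b q^n and let u_n(x; B) be the sum over j of
    (q^-n; q)_j (B; q)_j / (q; q)_j (qx)^j; then replacing b by tb replaces B by
    tB, and everything is about the zeros of u_n(.; B) as B < 0 varies.

    Steps by powers of q.  Two contiguous relations, [bes_rec] and
    [bes_shift_rec], express u_(n+1)(.; B) and u_(n+1)(.; qB) through the same
    pair u_n(.; B), u_n(.; qB).  With the values 1 at x = 0 and B^n at x = 1
    they give, by induction on n, that u_n(.; B) has n simple zeros in (0, 1) at
    which u_n(.; qB) alternates in sign ([exists_zeros]).  A polynomial with n
    positive zeros which alternates in sign at n + 1 points has exactly one zero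
    between consecutive points ([alternation_interlaces]).  For the points
    consisting of the zeros of u_n(.; B) and of 1 this shows that these zeros
    interlace with those of u_n(.; qB) and of u_n(.; q^2 B); for the points
    consisting of q times the zeros and of 1 it yields the bound on the
    logarithmic mesh, because u_n(qx; B) is a combination of u_n(x; B) and
    u_n(x; qB) ([zer_mesh]).

    Intermediate parameters.  Fix x in (0, 1) and regard u_n(x; B) as a
    polynomial in B.  Its coefficient of B^k is a positive number times
    x^k (1 - x) (1 - x/q) ... (1 - x/q^(n-k-1)), so by the rule of signs it has
    at most m negative roots, where m is the number of i < n with x < q^i
    ([size_param_roots]).  Along the sequence q^k B, with k running through the
    integers, the number of zeros of u_n(.; q^k B) which are at most x decreases
    from n to n - m, by at most one at each step, and each decrease produces
    a root between two consecutive terms ([lattice_roots]).  This accounts for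
    all m roots.  Hence u_n(x; .) has no root between B and qB when no zero
    crosses x there ([gap_no_root]), and the sign of u_n(x; tB) is known
    for q <= t <= 1.  These signs force each zero of u_n(.; tB) to lie between
    the corresponding zeros of u_n(.; B) and u_n(.; qB) ([zer_monotone]).  For
    q^2 < t < q the same applies from qB on, and the interlacing of B with
    q^2 B closes the argument ([preceq_scaled]). *)

Import Order.TTheory GRing.Theory Num.Theory.
Import numFieldNormedType.Exports.
Local Open Scope classical_set_scope.
Local Open Scope ring_scope.

Set Implicit Arguments.
Unset Strict Implicit.
Unset Printing Implicit Defensive.

(** * Polynomials with alternating signs *)

Section AlternatingSigns.
Variable R : rcfType.
Implicit Types (p : {poly R}) (s : seq R) (y : nat -> R) (x : R) (i k : nat).

Definition alternates p y k :=
  forall i, (i <= k)%N -> 0 < (-1) ^+ i * p.[y i].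

Lemma nth_increasing s :
  (forall i, (i.+1 < size s)%N -> s`_i < s`_i.+1) -> sorted <%R s.
Proof. by move=> h; apply/(sortedP 0) => i /h. Qed.

Lemma opposite_signs i (u v : R) :
  0 < (-1) ^+ i.+1 * u -> 0 < (-1) ^+ i * v -> u * v < 0.
Proof.
move=> hu hv; have := mulr_gt0 hu hv.
rewrite [ltRHS](_ : _ = - (((-1) ^+ i) ^+ 2 * (u * v))); last by rewrite exprS; ring.
by rewrite sqrr_sign mul1r oppr_gt0.
Qed.

Lemma alternation_roots p y k :
    (forall i, (i < k)%N -> y i < y i.+1) -> alternates p y k ->
  exists s, [/\ size s = k, all (root p) s, sorted <%R s &
    forall i, (i < k)%N -> y i < s`_i < y i.+1].
Proof.
move=> yinc alt.
suff [s [ss rs hs]] : exists s, [/\ size s = k, all (root p) s &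
    forall i, (i < k)%N -> y i < s`_i < y i.+1].
  exists s; split=> //; apply: nth_increasing => i; rewrite ss => ik.
  have /andP[_ h1] := hs i (ltnW ik); have /andP[h2 _] := hs _ ik.
  exact: lt_trans h1 h2.
elim: k yinc alt => [|k IH] yinc alt; first by exists [::].
have [||s [ss rs hs]] := IH.
- by move=> i ik; apply: yinc; exact: ltnW.
- by move=> i ik; apply: alt; exact: leqW.
have [] := @poly_ivtoo _ p (y k) (y k.+1).
- exact/ltW/yinc.
- rewrite mulrC.
  exact: opposite_signs (alt k.+1 (leqnn _)) (alt k (leqnSn _)).
move=> x xI rx; exists (rcons s x); split.
- by rewrite size_rcons ss.
- by rewrite all_rcons rx rs.
- move=> i; rewrite nth_rcons ss ltnS leq_eqVlt => /predU1P[->|ik].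
    by rewrite ltnn eqxx; move: xI; rewrite in_itv.
  by rewrite ik hs.
Qed.

Lemma split_simple_roots p s :
    sorted <%R s -> all (root p) s -> size p = (size s).+1 ->
  p = lead_coef p *: \prod_(z <- s) ('X - z%:P).
Proof.
move=> ss rs sp; apply: all_roots_prod_XsubC => //.
by rewrite uniq_rootsE; exact: (sorted_uniq lt_trans ltxx).
Qed.

(** Comparison with the value at 0: a factor changes sign between 0 and x
    exactly when its root lies in between. *)
Lemma sign_count_roots p s c x :
    p = c *: \prod_(z <- s) ('X - z%:P) -> 0 < p.[0] ->
    all (fun z => 0 < z) s -> p.[x] != 0 ->
  0 < (-1) ^+ count (< x) s * p.[x].
Proof.
move=> -> {p}; rewrite !hornerZ => p0 spos px0.
suff h : 0 < (-1) ^+ count (< x) s * ((\prod_(z <- s) ('X - z%:P)).[0] *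
     (\prod_(z <- s) ('X - z%:P)).[x]).
  move: px0; rewrite mulf_eq0 negb_or => /andP[c0 _].
  rewrite -(pmulr_rgt0 _ p0).
  rewrite [ltRHS](_ : _ = c ^+ 2 * ((-1) ^+ count (< x) s *
    ((\prod_(z <- s) ('X - z%:P)).[0] *
     (\prod_(z <- s) ('X - z%:P)).[x]))); last by ring.
  by rewrite mulr_gt0// exprn_even_gt0.
move: px0; rewrite mulf_eq0 negb_or => /andP[_].
elim: s spos {p0} => [_ _|z s IH /= /andP[z0 spos]].
  by rewrite big_nil !hornerE/= ltr01.
rewrite !big_cons !hornerM !hornerXsubC sub0r mulf_eq0 negb_or => /andP[xz px].
have {IH} := IH spos px.
set P := _.[0]; set Q := _.[x]; set e := (-1) ^+ _ => h.
have [zx|xz'] := ltP z x.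
  rewrite add1n exprS -/e [ltRHS](_ : _ = z * (x - z) * (e * (P * Q))); last by ring.
  by rewrite (mulr_gt0 (mulr_gt0 z0 _) h)// subr_gt0.
rewrite add0n -/e [ltRHS](_ : _ = z * (z - x) * (e * (P * Q))); last by ring.
by rewrite (mulr_gt0 (mulr_gt0 z0 _) h)// subr_gt0 lt_neqAle xz' andbT -subr_eq0.
Qed.

(** The parities push the values up by at least one at each step, and the bound
    at the end leaves no room for more. *)
Lemma parity_forced (f : nat -> nat) k :
    (forall i, (i < k)%N -> (f i <= f i.+1)%N) -> (f k <= k)%N ->
    (forall i, (i <= k)%N -> odd (f i) = odd i) ->
  forall i, (i <= k)%N -> f i = i.
Proof.
move=> finc fk fodd.
have lb i : (i <= k)%N -> (i <= f i)%N.
  elim: i => // i IH ik; have h1 := IH (ltnW ik); have h2 := finc _ ik.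
  have := fodd _ ik; have := leq_trans h1 h2; rewrite leq_eqVlt => /predU1P[<-|//] /=.
  by case: (odd i).
move=> i ik; apply/eqP; rewrite eqn_leq lb// andbT.
rewrite -(subKn ik); move: (k - i)%N (leq_subr i k) => j; elim: j => [|j IH] jk.
  by rewrite subn0.
have h1 := IH (ltnW jk).
have kj : (k - j = (k - j.+1).+1)%N by lia.
have lt1 : (k - j.+1 < k)%N by lia.
have h2 := finc _ lt1; rewrite -kj in h2.
have h3 := leq_trans h2 h1.
have h4 := fodd _ (ltnW lt1).
move: h3; rewrite kj leq_eqVlt => /predU1P[h|//].
by move: h4; rewrite h /=; case: odd.
Qed.

Lemma odd_eq_of_sign (a b : nat) (v : R) :
  0 < (-1) ^+ a * v -> 0 < (-1) ^+ b * v -> odd a = odd b.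
Proof.
rewrite -(signr_odd R a) -(signr_odd R b).
by case: odd; case: odd; rewrite //= ?expr0 ?expr1 ?mul1r ?mulN1r ?oppr_gt0 => h1 h2;
  have := lt_trans h1 h2; rewrite ltxx.
Qed.

(** The number of roots to the left of y i has the parity of i; being monotone
    and at most k, it must equal i. *)
Lemma alternation_interlaces p s c y k :
    p = c *: \prod_(z <- s) ('X - z%:P) -> 0 < p.[0] ->
    all (fun z => 0 < z) s -> sorted <%R s -> size s = k ->
    (forall i, (i < k)%N -> y i < y i.+1) -> alternates p y k ->
  forall i, (i < k)%N -> y i < s`_i < y i.+1.
Proof.
move=> pE p0 spos ss sk yinc alt.
have py i : (i <= k)%N -> p.[y i] != 0.
  by move=> /alt h; apply: contraTneq h => ->; rewrite mulr0 ltxx.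
have cE : forall i, (i <= k)%N -> count (< y i) s = i.
  apply: (@parity_forced (fun i => count (< y i) s)).
  - by move=> i ik; apply: sub_count => z /= zy; apply: lt_trans zy (yinc _ ik).
  - by rewrite -{2}sk count_size.
  move=> i ik; apply: (odd_eq_of_sign (sign_count_roots pE p0 spos (py _ ik))).
  exact: alt.
have ss' : sorted <=%R s by apply: sub_sorted ss => ? ? /ltW.
move=> i ik; apply/andP; split; last first.
  by apply: nth_count_lt => //; rewrite (cE i.+1).
rewrite lt_neqAle nth_count_ge ?andbT//; last by rewrite (cE i (ltnW ik)) leqnn sk.
apply: contraNneq (py i (ltnW ik)) => ->.
have /rootP r0 : root (\prod_(z <- s) ('X - z%:P)) s`_i.
  by rewrite root_prod_XsubC mem_nth// sk.
by rewrite pE hornerZ r0 mulr0.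
Qed.

Lemma count_lt_sorted s i x :
    sorted <%R s -> (i <= size s)%N ->
    ((0 < i)%N -> s`_i.-1 < x) -> ((i < size s)%N -> x < s`_i) ->
  count (< x) s = i /\ x \notin s.
Proof.
move=> ss si lo hi.
have ss' : sorted <=%R s by apply: sub_sorted ss => ? ? /ltW.
have cE : count (< x) s = i.
  apply/eqP; rewrite eqn_leq leqNgt; apply/andP; split.
    apply/negP => ic; have := nth_count_lt 0 ss' ic; apply/negP.
    by rewrite -leNgt ltW// hi// (leq_trans ic (count_size _ _)).
  rewrite leqNgt; apply/negP => ci; have i0 : (0 < i)%N by exact: leq_trans ci.
  have : x <= s`_i.-1 by rewrite nth_count_ge// -ltnS !prednK ?ci.
  by rewrite leNgt lo.
split=> //; apply/negP => /(nthP 0)[j js xE].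
have [ji|ij] := ltnP j i.
  have i0 : (0 < i)%N by exact: leq_trans ji.
  have : s`_j <= s`_i.-1.
    by apply: (le_sorted_leq_nth 0 ss'); rewrite ?inE// -ltnS prednK.
  by rewrite xE leNgt lo.
have : s`_i <= s`_j.
  by apply: (le_sorted_leq_nth 0 ss'); rewrite ?inE// (leq_ltn_trans ij js).
by rewrite xE leNgt hi// (leq_ltn_trans ij js).
Qed.

End AlternatingSigns.

(** * Counting positive roots with Rolle's theorem *)

Section PositiveRoots.
Variable R : rcfType.
Implicit Types (p : {poly R}) (s : seq R).

Lemma rolle_roots p x s : path <%R x s -> all (root p) (x :: s) ->
  exists s', [/\ size s' = size s, all (root p^`()) s' & path <%R x s'].
Proof.
elim: s x => [|z s IH] x /=; first by exists [::].
move=> /andP[xz zs] /and3P[/rootP px /rootP pz ps].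
have [s' [ss' rs' ps']] : exists s',
    [/\ size s' = size s, all (root p^`()) s' & path <%R z s'].
  by apply: IH => //=; rewrite ps andbT; apply/rootP.
have [c] := poly_rolle xz (etrans px (esym pz)).
rewrite in_itv /= => /andP[xc cz] /rootP rc.
exists (c :: s') => /=; split; rewrite ?ss' ?rc//= xc /=.
by case: s' ps' {ss' rs'} => //= w s' /andP[zw ->]; rewrite (lt_trans cz zw).
Qed.

(** Each differentiation costs at most one positive root. *)
Lemma size_positive_roots p m s :
    (forall x, 0 < x -> p^`(m).[x] != 0) ->
    uniq s -> all (fun x => 0 < x) s -> all (root p) s -> (size s <= m)%N.
Proof.
elim: m p s => [|m IH] p s pm us spos rs.
  by case: s rs spos {us} => //= x s /andP[/rootP + _] /andP[/pm/eqP].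
have : sorted <%R (sort <=%R s) by rewrite sort_lt_sorted.
have : all (root p) (sort <=%R s) by rewrite all_sort.
have : all (fun x => 0 < x) (sort <=%R s) by rewrite all_sort.
rewrite -(size_sort <=%R s); case: (sort _ s) => // x s' /andP[x0 _] rs' ps'.
have [t [st rt pt]] := @rolle_roots p x s' ps' rs'.
rewrite /= ltnS -st; apply: (IH p^`()) => //.
- by move=> z /pm; rewrite derivSn.
- by move/path_sorted/(sorted_uniq lt_trans ltxx): pt.
- move: pt; rewrite (path_sortedE lt_trans) => /andP[/allP xt _].
  by apply/allP => z /xt; exact: lt_trans.
Qed.

End PositiveRoots.

(** * Contiguous relations *)

Section QBessel.
Variables (R : realType) (q : R).
Hypotheses (q_gt0 : 0 < q) (q_lt1 : q < 1).
Implicit Types (n m j k : nat) (B x : R).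

Let q_neq0 : q != 0. Proof. exact: lt0r_neq0. Qed.

(** The q-Bessel polynomial of parameter b is the case B = b q^n: in terms of B
    the contiguous relations below keep the parameter fixed while the degree
    grows. *)
Definition bessel_poly n B : {poly R} :=
  \sum_(j < n.+1)
    (qpoch (q ^- n) q j * qpoch B q j / qpoch q q j) *: (q *: 'X) ^+ j.

Local Notation bes := bessel_poly.

Definition bcoef n B j : R :=
  qpoch (q ^- n) q j * qpoch B q j / qpoch q q j * q ^+ j.

Lemma qpoch0 c : qpoch c q 0 = 1.
Proof. by rewrite /qpoch big_ord0. Qed.

Lemma qpochSr c j : qpoch c q j.+1 = qpoch c q j * (1 - c * q ^+ j).
Proof. by rewrite /qpoch big_ord_recr. Qed.

Lemma qpochSl c j : qpoch c q j.+1 = (1 - c) * qpoch (q * c) q j.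
Proof.
rewrite /qpoch big_ord_recl expr0 mulr1; congr (_ * _).
by apply: eq_bigr => i _; rewrite exprS mulrA (mulrC c).
Qed.

Lemma sub1Xq_gt0 j : 0 < 1 - q ^+ j.+1.
Proof. by rewrite subr_gt0 exprn_ilt1// ltW. Qed.

Lemma qpoch_qq_gt0 j : 0 < qpoch q q j.
Proof.
by rewrite /qpoch prodr_gt0// => i _; rewrite -exprS sub1Xq_gt0.
Qed.

(** This makes the formula for the coefficients valid in all degrees. *)
Lemma qpoch_vanish n j : (n < j)%N -> qpoch (q ^- n) q j = 0.
Proof.
move=> nj; rewrite /qpoch (bigD1 (Ordinal nj))//= mulVf ?subrr ?mul0r//.
by rewrite expf_neq0.
Qed.

Lemma coef_bes n B j : (bes n B)`_j = bcoef n B j.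
Proof.
rewrite /bessel_poly; under eq_bigr do rewrite exprZn scalerA.
rewrite -(poly_def n.+1 (bcoef n B)) coef_poly ltnS; case: leqP => // nj.
by rewrite /bcoef qpoch_vanish// !mul0r.
Qed.

Lemma bcoef0 n B : bcoef n B 0 = 1.
Proof. by rewrite /bcoef !qpoch0 expr0 invr1 !mulr1. Qed.

Lemma size_bes_le n B : (size (bes n B) <= n.+1)%N.
Proof.
by apply/leq_sizeP => j nj; rewrite coef_bes /bcoef qpoch_vanish ?mul0r.
Qed.

Lemma bes_rec n B :
  bes n.+1 B = bes n B - (q ^- n * (1 - B)) *: ('X * bes n (q * B)).
Proof.
apply/polyP => -[|j]; rewrite !coefB !coefZ coefXM !coef_bes /=.
  by rewrite !bcoef0 mulr0 subr0.
rewrite /bcoef (qpochSl (q ^- n.+1)) (qpochSr (q ^- n)) (qpochSl B).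
rewrite (qpochSr q) [q * q ^- n.+1](_ : _ = q ^- n); last first.
  by rewrite exprS invfM mulrA divff ?mul1r.
have h1 := lt0r_neq0 (qpoch_qq_gt0 j); have h2 := lt0r_neq0 (sub1Xq_gt0 j).
rewrite -exprS; move: h2; rewrite !exprS => h2.
by field; rewrite h2 h1 q_neq0 expf_neq0.
Qed.

Lemma bes_shift_rec n B :
  bes n.+1 (q * B) =
    bes n B - (q ^- n * (1 - B * q ^+ n.+1)) *: ('X * bes n (q * B)).
Proof.
apply/polyP => -[|j]; rewrite !coefB !coefZ coefXM !coef_bes /=.
  by rewrite !bcoef0 mulr0 subr0.
rewrite /bcoef (qpochSl (q ^- n.+1)) (qpochSr (q ^- n)) (qpochSl B).
rewrite (qpochSr q) (qpochSr (q * B)) [q * q ^- n.+1](_ : _ = q ^- n); last first.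
  by rewrite exprS invfM mulrA divff ?mul1r.
have h1 := lt0r_neq0 (qpoch_qq_gt0 j); have h2 := lt0r_neq0 (sub1Xq_gt0 j).
rewrite -exprS; move: h2; rewrite !exprS => h2.
by field; rewrite h2 h1 q_neq0 expf_neq0.
Qed.

(** Since (1 - B) (qB; q)_j = (B; q)_j (1 - B q^j), and q^j is the effect of
    the dilation by q on x^j. *)
Lemma bes_dilation n B x :
  (1 - B) * (bes n (q * B)).[x] = (bes n B).[x] - B * (bes n B).[q * x].
Proof.
rewrite !(horner_coef_wide _ (size_bes_le _ _)) !mulr_sumr -sumrB.
apply: eq_bigr => j _; rewrite !coef_bes /bcoef exprMn.
have : (1 - B) * qpoch (q * B) q j = qpoch B q j * (1 - B * q ^+ j).
  by rewrite -qpochSl qpochSr.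
move=> e; rewrite [LHS](_ : _ = qpoch (q ^- n) q j *
  ((1 - B) * qpoch (q * B) q j) / qpoch q q j * q ^+ j * x ^+ j); last by ring.
by rewrite e; ring.
Qed.

Lemma horner_bes0 n B : (bes n B).[0] = 1.
Proof. by rewrite horner_coef0 coef_bes bcoef0. Qed.

(** A case of the q-Chu-Vandermonde sum: at x = 1 the factor q^-n of the
    recursion cancels against (qB)^n. *)
Lemma horner_bes1 n B : (bes n B).[1] = B ^+ n.
Proof.
elim: n B => [|n IH] B.
  by rewrite /bessel_poly big_ord1 !qpoch0 expr0 invr1 !mulr1 scale1r hornerC.
rewrite bes_rec hornerD hornerN hornerZ hornerM hornerX !IH exprMn exprS.
by field; rewrite expf_neq0.
Qed.

Lemma qpoch_neg_gt0 j B : B < 0 -> 0 < qpoch B q j.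
Proof.
move=> B0; rewrite /qpoch prodr_gt0// => i _.
by rewrite subr_gt0 (lt_trans _ ltr01)// nmulr_rlt0// exprn_gt0.
Qed.

Lemma bcoef_top_neq0 n B : B < 0 -> bcoef n B n != 0.
Proof.
move=> B0.
have h1 := lt0r_neq0 (qpoch_neg_gt0 n B0); have h2 := lt0r_neq0 (qpoch_qq_gt0 n).
suff h3 : qpoch (q ^- n) q n != 0.
  by rewrite /bcoef !mulf_neq0// ?invr_eq0// expf_neq0.
apply/prodf_neq0 => i _; rewrite subr_eq0 eq_sym.
apply: contraTneq (ltn_ord i) => e; rewrite -leqNgt.
have : q ^+ n = q ^+ i by rewrite -[LHS]mulr1 -e mulrA divff ?mul1r// expf_neq0.
by move/eqP; rewrite eq_le => /andP[_]; rewrite ler_iXn2l.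
Qed.

Lemma size_bes n B : B < 0 -> size (bes n B) = n.+1.
Proof.
move=> B0; apply/eqP; rewrite eqn_leq size_bes_le /=.
rewrite ltnNge; apply: contra (bcoef_top_neq0 n B0).
by move=> /leq_sizeP/(_ n (leqnn n)); rewrite coef_bes => ->.
Qed.

End QBessel.

(** * Existence of the zeros *)

Section ZeroExistence.
Variables (R : realType) (q : R).
Hypotheses (q_gt0 : 0 < q) (q_lt1 : q < 1).
Implicit Types (n m i j k : nat) (B x : R) (s : seq R).

Local Notation bes := (bessel_poly q).
Let q_neq0 : q != 0. Proof. exact: lt0r_neq0. Qed.

Definition is_zeros n B s :=
  [/\ size s = n, sorted <%R s, all (fun z => 0 < z < 1) s &
    bes n B = lead_coef (bes n B) *: \prod_(z <- s) ('X - z%:P)].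

Lemma zeros_sign n B s i x :
    is_zeros n B s -> (i <= n)%N ->
    ((0 < i)%N -> s`_i.-1 < x) -> ((i < n)%N -> x < s`_i) ->
  0 < (-1) ^+ i * (bes n B).[x].
Proof.
move=> [ss srt s01 pE] i_n lo hi.
have [<- xs] : count (< x) s = i /\ x \notin s.
  by apply: count_lt_sorted; rewrite ?ss.
apply: (sign_count_roots pE).
- by rewrite horner_bes0// ltr01.
- by apply: sub_all s01 => z /andP[].
rewrite pE hornerZ mulf_neq0//.
  rewrite lead_coef_eq0; apply/eqP => b0; have := horner_bes0 q_gt0 n B.
  by rewrite b0 horner0 => /eqP; rewrite eq_sym oner_eq0.
by rewrite -/(root _ x) root_prod_XsubC.
Qed.

Lemma zeros_interlace n B s (y : nat -> R) :
    is_zeros n B s -> (forall i, (i < n)%N -> y i < y i.+1) ->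
    alternates (bes n B) y n ->
  forall i, (i < n)%N -> y i < s`_i < y i.+1.
Proof.
move=> [ss srt s01 pE]; apply: alternation_interlaces => //; first exact: pE.
- by rewrite horner_bes0// ltr01.
- by apply: sub_all s01 => z /andP[].
Qed.

Lemma sign_horner_bes1 n B : B < 0 -> 0 < (-1) ^+ n * (bes n B).[1].
Proof.
by move=> B0; rewrite horner_bes1// -exprMn mulN1r exprn_gt0// oppr_gt0.
Qed.

(** The default value of [nth] supplies the endpoint 1. *)
Definition framed s i := nth 1 (0 :: s) i.

Lemma framedS s i : (i < size s)%N -> framed s i.+1 = s`_i.
Proof. by move=> si; rewrite /framed /=; exact: set_nth_default. Qed.

Lemma framed_end s : framed s (size s).+1 = 1.
Proof. by rewrite /framed /= nth_default. Qed.

(** At the zeros of u_n(.; B) the recursion leaves only -x u_n(x; qB), up to a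
    positive factor, so u_(n+1)(.; B) alternates at these zeros framed by 0 and
    1. At a zero of u_(n+1)(.; B) the relation for u_(n+1)(.; qB) leaves a
    positive multiple of u_n(x; B), which carries the alternation to the next
    degree. *)
Lemma exists_zeros n B : B < 0 ->
  exists s, is_zeros n B s /\
    forall i, (i < n)%N -> 0 < (-1) ^+ i * (bes n (q * B)).[s`_i].
Proof.
have qn_gt0 m : 0 < q ^- m by rewrite invr_gt0 exprn_gt0.
move=> B0; have B1 : 0 < 1 - B by rewrite subr_gt0 (lt_trans B0).
elim: n => [|n [s [sz sgn]]].
  exists [::]; split=> //; split=> //.
  rewrite big_nil alg_polyC {1}[bes 0 B]size1_polyC ?size_bes//.
  by rewrite lead_coefE size_bes.
have [ss srt s01 pE] := sz.
have s_in j : (j < n)%N -> 0 < s`_j < 1.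
  by move=> jn; apply: (allP s01); rewrite mem_nth ?ss.
have fend : framed s n.+1 = 1 by rewrite -ss framed_end.
have inc i : (i < n.+1)%N -> framed s i < framed s i.+1.
  rewrite ltnS leq_eqVlt => /predU1P[->|i_n].
    rewrite fend; case: n ss sz s_in {sgn pE fend} => [|m] ss sz s_in.
      by rewrite /framed /= ltr01.
    by rewrite framedS ?ss//; have /andP[] := s_in m (leqnn _).
  rewrite framedS ?ss//; case: i i_n => [|i] i_n; first by have /andP[] := s_in _ i_n.
  by rewrite framedS ?ss 1?ltnW// lt_sorted_ltn_nth ?inE ?ss// ltnW.
have alt : alternates (bes n.+1 B) (framed s) n.+1.
  case=> [_|i]; first by rewrite /framed /= expr0 mul1r horner_bes0// ltr01.
  rewrite ltnS leq_eqVlt => /predU1P[->|i_n].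
    by rewrite fend sign_horner_bes1.
  rewrite framedS ?ss//.
  have p0 : (bes n B).[s`_i] = 0.
    rewrite pE hornerZ (rootP _) ?mulr0//.
    by rewrite root_prod_XsubC mem_nth ?ss.
  rewrite bes_rec// hornerD hornerN hornerZ hornerM hornerX p0 sub0r exprS.
  rewrite [ltRHS](_ : _ = (q ^- n * (1 - B) * s`_i) *
    ((-1) ^+ i * (bes n (q * B)).[s`_i])); last by ring.
  have /andP[si0 _] := s_in _ i_n.
  by rewrite (mulr_gt0 _ (sgn _ i_n))// !mulr_gt0.
have [t [st rt tt tb]] := alternation_roots inc alt.
exists t; split.
  split=> //; last by apply: split_simple_roots => //; rewrite st size_bes.
  apply/(all_nthP 0) => i; rewrite st => i_n; have /andP[lo hi] := tb _ i_n.
  have f01 j : (j <= n.+1)%N -> 0 <= framed s j <= 1.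
    case: j => [|j]; first by rewrite /framed /= lexx ler01.
    rewrite ltnS leq_eqVlt => /predU1P[->|jn]; first by rewrite fend lexx ler01.
    by rewrite framedS ?ss//; have /andP[/ltW-> /ltW->] := s_in _ jn.
  have /andP[l0 _] := f01 _ (ltnW i_n); have /andP[_ h1] := f01 _ i_n.
  by rewrite (le_lt_trans l0 lo) (lt_le_trans hi h1).
move=> i i_n; have /andP[lo hi] := tb _ i_n.
set x := t`_i in lo hi *.
have x0 : 0 < x.
  apply: le_lt_trans lo; case: i i_n {hi x} => [|i] i_n; first by [].
  by rewrite framedS ?ss//; have /andP[/ltW] := s_in i i_n.
have /rootP : root (bes n.+1 B) x by apply: (allP rt); rewrite mem_nth ?st.
rewrite bes_rec// bes_shift_rec// !(hornerD, hornerN, hornerZ, hornerM, hornerX).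
have : 0 < (-1) ^+ i * (bes n B).[x].
  apply: (zeros_sign sz) => //.
  - by move=> i0; move: lo; rewrite -{1}(prednK i0) framedS// ss prednK.
  - by move=> i_n'; move: hi; rewrite framedS ?ss.
set u := (bes n B).[x]; set v := (bes n (q * B)).[x].
move=> u_sgn /eqP; rewrite subr_eq0 => /eqP uE.
move: u_sgn; rewrite uE.
rewrite [X in 0 < X -> _](_ : _ =
  (q ^- n * (1 - B) * x) * ((-1) ^+ i * v)); last by ring.
rewrite pmulr_rgt0; last by rewrite !mulr_gt0.
move=> v_sgn.
rewrite [ltRHS](_ : _ =
  (q ^- n * (- B) * (1 - q ^+ n.+1) * x) * ((-1) ^+ i * v)); last by ring.
by rewrite (mulr_gt0 _ v_sgn)// !mulr_gt0// ?oppr_gt0// sub1Xq_gt0.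
Qed.

End ZeroExistence.

(** * Interlacing and location of the zeros *)

Section ZeroLocation.
Variables (R : realType) (q : R).
Hypotheses (q_gt0 : 0 < q) (q_lt1 : q < 1).
Implicit Types (n m i j k : nat) (B x : R) (s : seq R).

Local Notation bes := (bessel_poly q).
Local Notation is_zeros := (is_zeros q).
Let q_neq0 : q != 0. Proof. exact: lt0r_neq0. Qed.

Definition bessel_zeros n B := real_zeros (bes n B).
Local Notation zer := bessel_zeros.

Lemma is_zeros_real_zeros n B s : B < 0 -> is_zeros n B s -> zer n B = s.
Proof.
move=> B0 [ss srt s01 pE]; rewrite /bessel_zeros pE real_zeros_prodXsubC//.
  by rewrite lead_coef_eq0 -size_poly_gt0 size_bes.
by apply: sub_sorted srt => ? ? /ltW.
Qed.

Lemma zerP n B : B < 0 -> is_zeros n B (zer n B).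
Proof.
move=> B0; have [s [h _]] := exists_zeros q_gt0 q_lt1 n B0.
by rewrite (is_zeros_real_zeros B0 h).
Qed.

Lemma zer_shift_sign n B i : B < 0 -> (i < n)%N ->
  0 < (-1) ^+ i * (bes n (q * B)).[(zer n B)`_i].
Proof.
move=> B0; have [s [h1 h2]] := exists_zeros q_gt0 q_lt1 n B0.
by rewrite (is_zeros_real_zeros B0 h1) => /h2.
Qed.

Lemma size_zer n B : B < 0 -> size (zer n B) = n.
Proof. by move=> /(zerP n)[]. Qed.

Lemma zer_itv n B i : B < 0 -> (i < n)%N -> 0 < (zer n B)`_i < 1.
Proof.
move=> B0 i_n; have [ss _ /allP s01 _] := zerP n B0.
by apply: s01; rewrite mem_nth ?ss.
Qed.

Lemma zer_increasing n B i j : B < 0 -> (i < j)%N -> (j < n)%N ->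
  (zer n B)`_i < (zer n B)`_j.
Proof.
move=> B0 ij jn; have [ss srt _ _] := zerP n B0.
by rewrite lt_sorted_ltn_nth// inE ss// (ltn_trans ij).
Qed.

Lemma zer_root n B i : B < 0 -> (i < n)%N -> (bes n B).[(zer n B)`_i] = 0.
Proof.
move=> B0 i_n; have [ss _ _ pE] := zerP n B0.
rewrite pE hornerZ (rootP _) ?mulr0// root_prod_XsubC mem_nth// ss//.
Qed.

(** The extra point 1 completes the n alternations, as every u_n(.; B) has the
    sign of (-1)^n there. *)
Lemma zer_interlace n B (w : nat -> R) : B < 0 ->
    (forall i, (i.+1 < n)%N -> w i < w i.+1) ->
    (forall i, (i < n)%N -> w i < 1) ->
    (forall i, (i < n)%N -> 0 < (-1) ^+ i * (bes n B).[w i]) ->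
  forall i, (i < n)%N ->
    w i < (zer n B)`_i /\ ((i.+1 < n)%N -> (zer n B)`_i < w i.+1).
Proof.
move=> B0 winc w1 wsgn.
pose y i := if (i < n)%N then w i else 1.
have h : forall i, (i < n)%N -> y i < (zer n B)`_i < y i.+1.
  apply: (zeros_interlace q_gt0 (zerP n B0)).
    move=> i i_n; rewrite /y i_n; case: ltnP => [|_]; [exact: winc | exact: w1].
  move=> i; rewrite leq_eqVlt => /predU1P[->|i_n]; last by rewrite /y i_n wsgn.
  by rewrite /y ltnn sign_horner_bes1.
move=> i i_n; have := h i i_n; rewrite /y i_n => /andP[-> hi]; split=> // i1.
by rewrite i1 in hi.
Qed.

Lemma shift_lt0 B : B < 0 -> q * B < 0.
Proof. by move=> B0; rewrite pmulr_rlt0. Qed.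

Lemma zer_shift n B i : B < 0 -> (i < n)%N ->
  (zer n B)`_i < (zer n (q * B))`_i /\
  ((i.+1 < n)%N -> (zer n (q * B))`_i < (zer n B)`_i.+1).
Proof.
move=> B0; apply: (zer_interlace (w := fun i => (zer n B)`_i)) => [|j jn|j jn|j jn].
- exact: shift_lt0.
- exact: zer_increasing.
- by have /andP[] := zer_itv B0 jn.
- exact: zer_shift_sign.
Qed.

(** The values U, V, W of u_n at x, for the parameters B, qB, q^2 B, satisfy
    two linear relations at a zero x of u_(n+1)(.; B); eliminating U and W
    leaves a positive multiple of V, whose sign is known. *)
Lemma zer_shift2_sign n B i : B < 0 -> (i < n)%N ->
  0 < (-1) ^+ i * (bes n (q * (q * B))).[(zer n B)`_i].
Proof.
case: n => // n B0 i_n; have sgn := zer_shift_sign B0 i_n.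
have px0 := zer_root B0 i_n; have /andP[x0 _] := zer_itv B0 i_n.
move: sgn px0; set x := (zer _ _)`_i in x0 *.
have qB0 := shift_lt0 B0.
have := bes_rec q_gt0 q_lt1 n (q * B).
rewrite !bes_shift_rec// bes_rec// => /(congr1 (fun p => p.[x])).
rewrite !(hornerD, hornerN, hornerZ, hornerM, hornerX).
set U := (bes n B).[x]; set V := (bes n (q * B)).[x].
set W := (bes n (q * (q * B))).[x].
have Qn0 : q ^- n != 0 by rewrite invr_eq0 expf_neq0.
have Qn_gt0 : 0 < q ^- n by rewrite invr_gt0 exprn_gt0.
have x_neq0 := lt0r_neq0 x0.
have B1 : 0 < 1 - q * B by rewrite subr_gt0 (lt_trans qB0).
have B1' := lt0r_neq0 B1.
move=> eW + /eqP; rewrite subr_eq0 => + /eqP eU.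
rewrite eU in eW *.
have qn1 := sub1Xq_gt0 q_gt0 q_lt1 n.
have -> : q ^- n * (1 - B) * (x * V) - q ^- n * (1 - B * q ^+ n.+1) * (x * V) =
    q ^- n * (- B) * (1 - q ^+ n.+1) * x * V by ring.
rewrite [X in 0 < X -> _](_ : _ =
  (q ^- n * (- B) * (1 - q ^+ n.+1) * x) * ((-1) ^+ i * V)); last by ring.
rewrite pmulr_rgt0; last by rewrite !mulr_gt0// oppr_gt0.
move=> V_sgn.
have eW' : q ^- n * (x * W) =
    (V - q ^- n * (- B) * (1 - q ^+ n.+1) * x * V) / (1 - q * B).
  apply: (mulIf B1'); rewrite divfK//.
  move/eqP: eW; rewrite -subr_eq0 => /eqP eW; apply/eqP; rewrite -subr_eq0; apply/eqP.
  by rewrite -eW; ring.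
rewrite [q ^- n * (1 - q * B * q ^+ n.+1) * (x * W)](_ : _ =
   (1 - q * B * q ^+ n.+1) * (q ^- n * (x * W))); last by ring.
rewrite eW'.
rewrite [ltRHS](_ : _ = ((1 - q ^+ n.+1) * (- B) *
    (q + (1 + - (q * B) * q ^+ n.+1) * q ^- n * x) / (1 - q * B)) *
    ((-1) ^+ i * V)); last first.
  by field; rewrite B1' expf_neq0.
rewrite (mulr_gt0 _ V_sgn)// divr_gt0// !mulr_gt0// ?oppr_gt0//.
by rewrite addr_gt0// !mulr_gt0// addr_gt0// mulr_gt0// ?oppr_gt0// exprn_gt0.
Qed.

Lemma zer_shift2 n B i : B < 0 -> (i.+1 < n)%N ->
  (zer n (q * (q * B)))`_i < (zer n B)`_i.+1.
Proof.
move=> B0 i_n.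
have [] := @zer_interlace n (q * (q * B)) (fun i => (zer n B)`_i) _ _ _ _ _ (ltnW i_n).
- exact/shift_lt0/shift_lt0.
- by move=> j; exact: zer_increasing.
- by move=> j jn; have /andP[] := zer_itv B0 jn.
- by move=> j; exact: zer_shift2_sign.
by move=> _; exact.
Qed.

(** At a zero x of u_n(.; B) the dilation formula shows that u_n(qx; B) has the
    sign of u_n(x; qB), so u_n(.; B) alternates at q times its zeros. *)
Lemma zer_mesh n B i : B < 0 -> (i.+1 < n)%N ->
  (zer n B)`_i < q * (zer n B)`_i.+1.
Proof.
move=> B0 i_n.
have [] := @zer_interlace n B (fun i => q * (zer n B)`_i) _ _ _ _ _ (ltnW i_n) => //.
- by move=> j jn; rewrite ltr_pM2l// zer_increasing.
- by move=> j jn; have /andP[h1 h2] := zer_itv B0 jn; rewrite mulr_ilt1// ltW.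
- move=> j jn; have := zer_shift_sign B0 jn; have := zer_root B0 jn.
  have := bes_dilation q_gt0 n B (zer n B)`_j.
  set u := (bes n (q * B)).[_]; set v := (bes n B).[q * _] => + e.
  rewrite e sub0r => uE h.
  have B1 : 0 < 1 - B by rewrite subr_gt0 (lt_trans B0).
  have : 0 < (1 - B) * ((-1) ^+ j * u) by rewrite mulr_gt0.
  by rewrite mulrCA uE -mulNr mulrCA pmulr_rgt0// oppr_gt0.
by move=> _; exact.
Qed.

Lemma zer_lt_expr n B i : B < 0 -> (i < n)%N -> (zer n B)`_i < q ^+ (n - i.+1).
Proof.
move=> B0 i_n; have [k kE] : exists k, (n - i.+1)%N = k by eexists.
rewrite kE; elim: k i i_n kE => [|k IH] i i_n kE.
  by rewrite expr0; have /andP[] := zer_itv B0 i_n.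
have i1 : (i.+1 < n)%N by lia.
apply: (lt_trans (zer_mesh B0 i1)); rewrite exprS ltr_pM2l// IH//; lia.
Qed.

Lemma geometric_sum n : (1 - q) * (\sum_(i < n) q ^+ i) = 1 - q ^+ n.
Proof.
elim: n => [|n IH]; first by rewrite big_ord0 expr0 mulr0 subrr.
by rewrite big_ord_recr mulrDr IH /= exprS; ring.
Qed.

(** The zeros add up to the negated quotient of the two top coefficients. *)
Lemma sum_zer n B : B < 0 -> (0 < n)%N ->
  (\sum_(i < n) (zer n B)`_i) * (1 - B * q ^+ n.-1) = \sum_(i < n) q ^+ i.
Proof.
case: n => // n B0 _.
have [ss _ _ pE] := zerP n.+1 B0.
have q1 : 1 - q != 0 by rewrite subr_eq0 eq_sym lt_eqF.
apply: (mulfI q1); rewrite geometric_sum.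
pose c := lead_coef (bes n.+1 B).
have c0 : c != 0 by rewrite lead_coef_eq0 -size_poly_gt0 size_bes.
have e1 : c = bcoef q n.+1 B n.+1 by rewrite /c lead_coefE size_bes// coef_bes.
have e2 : bcoef q n.+1 B n = - (c * \sum_(i < n.+1) (zer n.+1 B)`_i).
  rewrite -coef_bes// pE coefZ -mulrN; congr (_ * _).
  have := @coefPn_prod_XsubC _ (zer n.+1 B); rewrite ss /= => -> //; congr (- _).
  by rewrite (big_nth 0) ss big_mkord.
apply: (mulfI c0).
rewrite [LHS](_ : _ = (- (c * \sum_(i < n.+1) (zer n.+1 B)`_i)) *
  ((q - 1) * (1 - B * q ^+ n))); last by rewrite /=; ring.
rewrite -e2 e1 /bcoef !qpochSr.
have h1 := lt0r_neq0 (qpoch_qq_gt0 q_gt0 q_lt1 n).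
have h2 := lt0r_neq0 (sub1Xq_gt0 q_gt0 q_lt1 n).
move: h2; rewrite !exprS => h2.
by field; rewrite h2 h1 q_neq0 expf_neq0.
Qed.

Let ordsum_le (f : nat -> R) n i : (i < n)%N ->
  (forall j, (j < n)%N -> 0 <= f j) -> f i <= \sum_(j < n) f j.
Proof.
move=> i_n f0; rewrite (bigD1 (Ordinal i_n))//= lerDl sumr_ge0// => j _.
exact: f0.
Qed.

Lemma zer_le n B i : B < 0 -> (i < n)%N ->
  (zer n B)`_i * (- B * q ^+ n.-1) <= \sum_(j < n) q ^+ j.
Proof.
move=> B0 i_n; have n0 : (0 < n)%N by exact: leq_trans i_n.
rewrite -(sum_zer B0 n0).
have h : (zer n B)`_i <= \sum_(j < n) (zer n B)`_j.
  apply: (ordsum_le (f := fun j => (zer n B)`_j)) => // j.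
  by move=> /(zer_itv B0)/andP[/ltW].
have z0 : 0 < (zer n B)`_i by have /andP[] := zer_itv B0 i_n.
apply: ler_pM => //; first exact: ltW.
  by rewrite mulr_ge0 ?oppr_ge0 ?exprn_ge0// ltW.
by rewrite mulNr lerDr ler01.
Qed.

(** The zeros fall short of 1, q, ..., q^(n-1), their limits as B tends to 0;
    each deficit is positive, so it is at most the total deficit, which
    [sum_zer] computes. *)
Lemma zer_ge n B i : B < 0 -> (i < n)%N ->
  q ^+ (n - i.+1) - (\sum_(j < n) q ^+ j) * - B <= (zer n B)`_i.
Proof.
move=> B0 i_n; have n0 : (0 < n)%N by exact: leq_trans i_n.
have h : q ^+ (n - i.+1) - (zer n B)`_i <=
    \sum_(j < n) (q ^+ (n - j.+1) - (zer n B)`_j).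
  apply: (ordsum_le (f := fun j => q ^+ (n - j.+1) - (zer n B)`_j)) => // j jn.
  by rewrite subr_ge0 ltW// zer_lt_expr.
rewrite lerBlDr -lerBlDl; apply: (le_trans h); rewrite sumrB.
rewrite [X in X - _](_ : _ = \sum_(j < n) q ^+ j); last first.
  rewrite (reindex_inj rev_ord_inj); apply: eq_bigr => j _.
  by rewrite /= subnSK// subKn// ltnW.
rewrite -{1}(sum_zer B0 n0); set S := \sum_(j < n) _`_j.
have S0 : 0 <= S.
  by apply: sumr_ge0 => j _; have /andP[/ltW] := zer_itv B0 (ltn_ord j).
have qn1 : q ^+ n.-1 <= 1 by rewrite exprn_ile1// ltW.
have qn0 : 0 <= q ^+ n.-1 by rewrite exprn_ge0// ltW.
have Bq : 0 <= - B * q ^+ n.-1 by rewrite mulr_ge0// oppr_ge0 ltW.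
rewrite [leLHS](_ : _ = S * (- B * q ^+ n.-1)); last by ring.
apply: ler_pM => //.
  by rewrite -(sum_zer B0 n0) -/S ler_peMr// -mulNr lerDl.
by rewrite ler_piMr// oppr_ge0 ltW.
Qed.

Lemma exists_small_expr (d e : R) : 0 <= d -> 0 < e -> exists k, d * q ^+ k < e.
Proof.
move=> d0 e0.
have : (fun k => d * q ^+ k) @ \oo --> d * 0.
  by apply: cvgMr; apply: cvg_expr; rewrite ger0_norm// ltW.
rewrite mulr0 => /cvgr_lt /(_ _ e0) [k _ hk]; exists k; exact: (hk k (leqnn k)).
Qed.

End ZeroLocation.

(** * The values as polynomials in the parameter *)

Section ParameterPoly.
Variables (R : realType) (q : R).
Hypotheses (q_gt0 : 0 < q) (q_lt1 : q < 1).
Implicit Types (n m i j k l : nat) (B x : R) (s : seq R).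

Local Notation bes := (bessel_poly q).
Let q_neq0 : q != 0. Proof. exact: lt0r_neq0. Qed.

(** The positive factor of the coefficient of B^k: up to a power of q, a
    Gaussian binomial coefficient. *)
Fixpoint pweight n k : R :=
  if n is n'.+1 then
    pweight n' k + (if k is k'.+1 then q ^+ k' / q ^+ n' * pweight n' k' else 0)
  else (k == 0)%:R.

Lemma pweight_vanish n k : (n < k)%N -> pweight n k = 0.
Proof.
elim: n k => [|n IH] [|k]//= nk.
by rewrite !IH ?mulr0 ?addr0// ltnW.
Qed.

Lemma pweight_gt0 n k : (k <= n)%N -> 0 < pweight n k.
Proof.
have q_div i j : 0 < q ^+ i / q ^+ j by rewrite divr_gt0 ?exprn_gt0.
elim: n k => [|n IH] [|k]//= kn; first by rewrite addr0 IH.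
move: kn; rewrite ltnS leq_eqVlt => /predU1P[->|kn].
  by rewrite pweight_vanish// add0r mulr_gt0// IH.
by apply: addr_gt0; [exact: IH | apply: mulr_gt0 => //; exact/IH/ltnW].
Qed.

Definition rootprod x l := \prod_(i < l) (1 - x / q ^+ i).

(** The coefficient of B^k in u_n(x; B). *)
Definition pcoef n x k := pweight n k * x ^+ k * rootprod x (n - k).

Lemma pcoef_rec0 n x : pcoef n.+1 x 0 = (1 - q ^- n * x) * pcoef n x 0.
Proof.
by rewrite /pcoef /= !subn0 /rootprod big_ord_recr /= addr0; ring.
Qed.

Lemma pcoef_recS n x k :
  pcoef n.+1 x k.+1 =
    (1 - q ^- n * q ^+ k.+1 * x) * pcoef n x k.+1 +
    q ^- n * q ^+ k * x * pcoef n x k.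
Proof.
rewrite /pcoef subSS /= exprS.
have [kn|nk] := ltnP k n; last first.
  by rewrite pweight_vanish//; ring.
have [d nE] : exists d, n = (d + k.+1)%N by exists (n - k.+1)%N; rewrite subnK.
have -> : (n - k)%N = d.+1 by lia.
have -> : (n - k.+1)%N = d by lia.
rewrite /rootprod big_ord_recr /= nE exprD exprS.
by field; rewrite q_neq0 !expf_neq0.
Qed.

Definition param_poly n x : {poly R} := \poly_(k < n.+1) pcoef n x k.

Lemma horner_param_poly n x B : (param_poly n x).[B] = (bes n B).[x].
Proof.
rewrite horner_poly; elim: n B => [|n IH] B.
  rewrite big_ord1 /pcoef /= /rootprod big_ord0 !expr0 !mulr1.
  by rewrite /bessel_poly big_ord1 !qpoch0 !expr0 invr1 !mulr1 scale1r hornerC.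
rewrite bes_rec// hornerD hornerN hornerZ hornerM hornerX -!IH.
pose S := \sum_(i < n) pcoef n x i.+1 * B ^+ i.+1.
pose T := \sum_(i < n) pcoef n x i.+1 * (q * B) ^+ i.+1.
have shift (f : nat -> R) (c : R) :
    \sum_(i < n.+1) f i * c ^+ i = f 0 + \sum_(i < n) f i.+1 * c ^+ i.+1.
  by rewrite big_ord_recl expr0 mulr1; congr (_ + _); apply: eq_bigr.
rewrite !shift -/S -/T big_ord_recl expr0 mulr1 pcoef_rec0.
have -> : \sum_(i < n.+1) pcoef n.+1 x (lift ord0 i) * B ^+ lift ord0 i =
    (S - q ^- n * x * T) + q ^- n * x * B * (pcoef n x 0 + T).
  under eq_bigr do rewrite lift0 pcoef_recS mulrDl.
  rewrite big_split; congr (_ + _).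
    have C0 : pcoef n x n.+1 = 0 by rewrite /pcoef pweight_vanish// !mul0r.
    rewrite big_ord_recr /= C0 !(mul0r, mulr0) addr0.
    by rewrite mulr_sumr -sumrB; apply: eq_bigr => i _; rewrite exprMn; ring.
  rewrite -(shift (pcoef n x)) mulr_sumr; apply: eq_bigr => i _.
  by rewrite exprMn exprS; ring.
by ring.
Qed.

(** The polynomial y^n u_n(x; -1/y) in y = -1/B. Reversing the order of the
    coefficients puts the part of constant sign in the high degrees, where it
    survives differentiation. *)
Definition reversed_param_poly n x : {poly R} :=
  \poly_(l < n.+1) ((-1) ^+ (n - l) * pcoef n x (n - l)).

Lemma root_reversed_param_poly n x B :
  B < 0 -> root (param_poly n x) B -> root (reversed_param_poly n x) (- B^-1).
Proof.
move=> B0 /rootP; rewrite horner_poly => h; apply/rootP; rewrite horner_poly.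
have Bn0 : - B != 0 by rewrite oppr_eq0 lt_eqF.
apply: (mulIf (expf_neq0 n Bn0)); rewrite mul0r -[RHS]h mulr_suml.
rewrite (reindex_inj rev_ord_inj); apply: eq_bigr => i _ /=.
have i_n : (i <= n)%N by rewrite -ltnS.
have -> : (- B) ^+ n = (- B) ^+ (n - i) * (- B) ^+ i by rewrite -exprD subnK.
rewrite subSS subKn// -invrN exprVn mulrA mulfVK ?expf_neq0//.
by rewrite mulrAC -exprMn mulN1r opprK mulrC.
Qed.

Lemma rootprod_sign m i x : 0 < x ->
    (forall j, (j < m)%N -> x < q ^+ j) -> (i != 0 -> q ^+ m <= x) ->
  0 <= (-1) ^+ i * rootprod x (m + i).
Proof.
move=> x0 lo; elim: i => [|i IH] hi.
  rewrite expr0 mul1r addn0 prodr_ge0// => j _.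
  by rewrite subr_ge0 ler_pdivrMr ?exprn_gt0// mul1r ltW// lo.
rewrite addnS /rootprod big_ord_recr /= -/(rootprod _ _) exprS.
rewrite [leRHS](_ : _ =
  ((-1) ^+ i * rootprod x (m + i)) * (x / q ^+ (m + i) - 1)); last by ring.
have qmx := hi isT.
rewrite mulr_ge0 ?IH// subr_ge0 ler_pdivlMr ?exprn_gt0// mul1r (le_trans _ qmx)//.
by rewrite ler_wiXn2l// ?ltW// leq_addr.
Qed.

Lemma rootprod_gt0 m x :
  (forall j, (j < m)%N -> x < q ^+ j) -> 0 < rootprod x m.
Proof.
move=> lo; rewrite prodr_gt0// => j _.
by rewrite subr_gt0 ltr_pdivrMr ?exprn_gt0// mul1r lo.
Qed.

(** Coefficients of y^l with l >= m keep a constant sign: each further factor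
    1 - x/q^i is at most 0 and compensates one factor -1. *)
Lemma reversed_derivn_sign n m x y : 0 < x -> (m <= n)%N ->
    (forall j, (j < m)%N -> x < q ^+ j) -> m = n \/ q ^+ m <= x -> 0 < y ->
  (reversed_param_poly n x)^`(m).[y] != 0.
Proof.
move=> x0 mn lo hi y0; set p := reversed_param_poly n x.
suff : 0 < (-1) ^+ (n - m) * p^`(m).[y].
  by apply: contraTneq => ->; rewrite mulr0 ltxx.
have pE i : (-1) ^+ (n - m) * p^`(m)`_i =
    (if (m + i <= n)%N then
       pweight n (n - (m + i)) * x ^+ (n - (m + i)) *
         ((-1) ^+ i * rootprod x (m + i))
     else 0) *+ (m + i) ^_ m.
  rewrite coef_derivn mulrnAr coef_poly ltnS; congr (_ *+ _).
  case: leqP => [mi|_]; last by rewrite mulr0.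
  have eN : (n - m + (n - (m + i)) = i + (n - (m + i)).*2)%N by lia.
  rewrite /pcoef subKn// mulrA -exprD eN exprD -muln2 exprM sqrr_sign; ring.
have coef_ge0 i : 0 <= (-1) ^+ (n - m) * p^`(m)`_i.
  rewrite pE mulrn_wge0//; case: leqP => // mi.
  rewrite mulr_ge0 ?rootprod_sign//.
    by rewrite mulr_ge0 ?exprn_ge0 ?ltW// pweight_gt0// leq_subr.
  by case: hi mi => // ->; rewrite -{2}(addn0 n) leq_add2l leqn0 => ->.
have coef0_gt0 : 0 < (-1) ^+ (n - m) * p^`(m)`_0.
  rewrite pE addn0 mn expr0 mul1r pmulrn_lgt0 ?ffact_gt0//.
  by rewrite !mulr_gt0 ?exprn_gt0 ?rootprod_gt0// pweight_gt0// leq_subr.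
have sp : (size p^`(m) <= n.+1)%N.
  apply/leq_sizeP => i ni; rewrite coef_derivn coef_poly ltnNge.
  by rewrite (leq_trans ni (leq_addl _ _)) mul0rn.
rewrite (horner_coef_wide _ sp) mulr_sumr big_ord_recl expr0 mulr1.
apply: ltr_wpDr => //; apply: sumr_ge0 => i _.
by rewrite mulrA mulr_ge0// exprn_ge0// ltW.
Qed.

(** The rule of signs for u_n(x; .), whose coefficients change sign at most m
    times. *)
Lemma size_param_roots n m x s : 0 < x -> (m <= n)%N ->
    (forall j, (j < m)%N -> x < q ^+ j) -> m = n \/ q ^+ m <= x ->
    uniq s -> all (fun B => B < 0) s -> all (root (param_poly n x)) s ->
  (size s <= m)%N.
Proof.
move=> x0 mn lo hi us s0 rs; rewrite -(size_map (fun B => - B^-1)).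
apply: (@size_positive_roots _ (reversed_param_poly n x)).
- by move=> y; exact: reversed_derivn_sign.
- by rewrite map_inj_uniq// => a b /oppr_inj/invr_inj.
- by apply/allP => _ /mapP[B /(allP s0) B0 ->]; rewrite oppr_gt0 invr_lt0.
- apply/allP => _ /mapP[B Bs ->]; apply: root_reversed_param_poly.
    exact: (allP s0).
  exact: (allP rs).
Qed.

Lemma exists_level n x : x < 1 ->
  exists m,
    [/\ (m <= n)%N, forall j, (j < m)%N -> x < q ^+ j & m = n \/ q ^+ m <= x].
Proof.
move=> x1; elim: n => [|n [m [mn lo hi]]]; first by exists 0; split=> //; left.
have [qmx|xqm] := leP (q ^+ m) x; first by exists m; split; [exact: leqW | | right].
case: hi => [mE|]; last by rewrite leNgt xqm.
exists n.+1; split=> //; last by left.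
move=> j; rewrite ltnS leq_eqVlt => /predU1P[->|jn]; first by rewrite -mE.
by rewrite lo// mE.
Qed.

End ParameterPoly.

(** * Monotonicity of the zeros in the parameter *)

Section ParameterMonotonicity.
Variables (R : realType) (q : R).
Hypotheses (q_gt0 : 0 < q) (q_lt1 : q < 1).
Implicit Types (n m i j k l : nat) (B c x : R) (s : seq R).

Local Notation bes := (bessel_poly q).
Local Notation zer := (bessel_zeros q).
Local Notation param_poly := (param_poly q).
Let q_neq0 : q != 0. Proof. exact: lt0r_neq0. Qed.

Let zer_sorted n B : B < 0 -> sorted <=%R (zer n B).
Proof.
by move=> /(zerP q_gt0 q_lt1 n)[_ srt _ _]; apply: sub_sorted srt => ? ? /ltW.
Qed.

Lemma bes_sign n B i x : B < 0 -> (i <= n)%N ->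
    ((0 < i)%N -> (zer n B)`_i.-1 < x) -> ((i < n)%N -> x < (zer n B)`_i) ->
  0 < (-1) ^+ i * (bes n B).[x].
Proof. by move=> B0; exact: (zeros_sign q_gt0 (zerP q_gt0 q_lt1 n B0)). Qed.

Definition zeros_upto n B x := count (<= x) (zer n B).

Lemma zeros_upto_shift n B x : B < 0 ->
  (zeros_upto n B x <= (zeros_upto n (q * B) x).+1)%N.
Proof.
move=> B0; have qB0 := shift_lt0 q_gt0 B0; rewrite leqNgt; apply/negP => h.
have i_n : ((zeros_upto n (q * B) x).+1 < n)%N.
  by apply: (leq_trans h); rewrite -{2}(size_zer q_gt0 q_lt1 n B0) count_size.
have z1 := nth_count_le 0 (zer_sorted n B0) h.
have [_ /(_ i_n) z2] := zer_shift q_gt0 q_lt1 B0 (ltnW i_n).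
have := @nth_count_gt _ _ x 0 _ (zeros_upto n (q * B) x) (zer_sorted n qB0).
rewrite size_zer// leqnn ltnW// => /(_ isT).
by apply/negP; rewrite -leNgt ltW// (lt_le_trans z2).
Qed.

(** If a zero moves across x while the parameter moves from B to qB, then
    u_n(x; .) changes sign. The interval is closed at B because a zero may
    start at x; by interlacing none can end there when a crossing occurs. *)
Lemma root_of_crossing n B x : B < 0 ->
    (zeros_upto n (q * B) x < zeros_upto n B x)%N ->
  exists2 c, B <= c < q * B & root (param_poly n x) c.
Proof.
move=> B0; have qB0 := shift_lt0 q_gt0 B0.
move iE : (zeros_upto n (q * B) x) => i iN.
have i_n : (i < n)%N.
  by apply: (leq_trans iN); rewrite -{2}(size_zer q_gt0 q_lt1 n B0) count_size.
have z1 := nth_count_le 0 (zer_sorted n B0) iN.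
have z2 : x < (zer n (q * B))`_i.
  apply: nth_count_gt; first exact: zer_sorted.
  by rewrite -/(zeros_upto _ _ _) iE leqnn size_zer.
have BqB : B < q * B by rewrite ltr_nMl.
have sgn_qB : 0 < (-1) ^+ i * (bes n (q * B)).[x].
  apply: bes_sign => //; first exact: ltnW.
  move=> i0; have i1 : (i.-1 < n)%N by rewrite (leq_ltn_trans (leq_pred i)).
  have [_] := zer_shift q_gt0 q_lt1 B0 i1; rewrite prednK// => /(_ i_n) h.
  exact: lt_le_trans h z1.
move: z1; rewrite le_eqVlt => /predU1P[xE|z1].
  exists B; first by rewrite lexx BqB.
  by apply/rootP; rewrite horner_param_poly// -xE zer_root.
have sgn_B : 0 < (-1) ^+ i.+1 * (bes n B).[x].
  apply: bes_sign => // i1.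
  by have [_ /(_ i1)] := zer_shift q_gt0 q_lt1 B0 i_n; exact: lt_trans.
have [] := @poly_ivtoo _ (param_poly n x) _ _ (ltW BqB).
  by rewrite !horner_param_poly//; exact: opposite_signs sgn_B sgn_qB.
move=> c; rewrite in_itv /= => /andP[Bc cB] rc.
by exists c => //; rewrite (ltW Bc).
Qed.

(** The half-open intervals of successive steps are disjoint, so the roots
    found in them are distinct. *)
Lemma lattice_roots n x k B : B < 0 ->
  exists s, [/\ uniq s, all (root (param_poly n x)) s,
    all (fun c => B <= c < q ^+ k * B) s &
    (zeros_upto n B x <= zeros_upto n (q ^+ k * B) x + size s)%N].
Proof.
elim: k B => [|k IH] B B0; first by exists [::]; rewrite expr0 mul1r addn0.
have qB0 := shift_lt0 q_gt0 B0.
have BqB : B < q * B by rewrite ltr_nMl.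
have [s [us rs bs hs]] := IH _ qB0.
have qE : q ^+ k * (q * B) = q ^+ k.+1 * B by rewrite exprSr mulrA.
rewrite {}qE in bs hs.
have [le|gt] := leqP (zeros_upto n B x) (zeros_upto n (q * B) x).
  exists s; split=> //; last exact: leq_trans hs.
  by apply: sub_all bs => c /andP[h ->]; rewrite (le_trans (ltW BqB) h).
have [c /andP[Bc cB] rc] := root_of_crossing B0 gt.
exists (c :: s); split=> /=.
- rewrite us andbT; apply/negP => /(allP bs) /andP[+ _].
  by apply/negP; rewrite -ltNge.
- by rewrite rc.
- rewrite Bc (lt_le_trans cB) /=; last first.
    by rewrite exprSr -mulrA ler_nMl// exprn_ile1// ltW.
  by apply: sub_all bs => d /andP[h ->]; rewrite (le_trans (ltW BqB) h).
- by rewrite addnS (leq_trans (zeros_upto_shift n x B0))// ltnS.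
Qed.

(** All zeros tend to 0 as B tends to minus infinity. *)
Lemma all_zeros_upto n x B : B < 0 -> 0 < x ->
  exists k, zeros_upto n (q ^- k * B) x = n.
Proof.
move=> B0 x0.
pose C := \sum_(j < n) q ^+ j.
have C0 : 0 <= C by apply: sumr_ge0 => j _; rewrite exprn_ge0// ltW.
have e0 : 0 < x * (- B * q ^+ n.-1) by rewrite !mulr_gt0 ?oppr_gt0 ?exprn_gt0.
have [k hk] := exists_small_expr q_gt0 q_lt1 C0 e0.
have qk0 : 0 < q ^+ k by rewrite exprn_gt0.
have kB0 : q ^- k * B < 0 by rewrite pmulr_rlt0// invr_gt0.
exists k; rewrite -[RHS](size_zer q_gt0 q_lt1 n kB0); apply/eqP; rewrite -all_count.
apply/(all_nthP 0) => i; rewrite size_zer// => i_n.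
have w0 : 0 < - (q ^- k * B) * q ^+ n.-1 by rewrite mulr_gt0 ?oppr_gt0 ?exprn_gt0.
rewrite /= -(ler_pM2r w0); apply: le_trans (zer_le q_gt0 q_lt1 kB0 i_n) _.
rewrite -/C [leRHS](_ : _ = x * (- B * q ^+ n.-1) / q ^+ k); last by ring.
by rewrite ler_pdivlMr// ltW.
Qed.

(** As B tends to 0 the zeros tend to 1, q, ..., q^(n-1), of which 1, ...,
    q^(m-1) exceed x. *)
Lemma few_zeros_upto n m x B : B < 0 -> (m <= n)%N ->
    (forall j, (j < m)%N -> x < q ^+ j) ->
  exists k, (zeros_upto n (q ^+ k * B) x <= n - m)%N.
Proof.
move=> B0; case: m => [|m] mn lo.
  by exists 0; rewrite expr0 mul1r subn0 -{2}(size_zer q_gt0 q_lt1 n B0) count_size.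
pose C := \sum_(j < n) q ^+ j.
have C0 : 0 <= C * - B.
  by rewrite mulr_ge0 ?oppr_ge0 ?sumr_ge0 ?(ltW B0)// => j _; rewrite exprn_ge0// ltW.
have e0 : 0 < q ^+ m - x by rewrite subr_gt0 lo.
have [k hk] := exists_small_expr q_gt0 q_lt1 C0 e0.
exists k; have kB0 : q ^+ k * B < 0 by rewrite pmulr_rlt0// exprn_gt0.
rewrite leqNgt; apply/negP => h.
have i_n : (n - m.+1 < n)%N by rewrite ltn_subrL (leq_ltn_trans _ mn).
have := nth_count_le 0 (zer_sorted n kB0) h; apply/negP; rewrite -ltNge.
apply: lt_le_trans (zer_ge q_gt0 q_lt1 kB0 i_n).
have -> : (n - (n - m.+1).+1 = m)%N by rewrite subnSK// subKn// ltnW.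
rewrite -/C ltrBrDl -ltrBrDr; apply: le_lt_trans hk.
by rewrite [leLHS](_ : _ = C * - B * q ^+ k)//; ring.
Qed.

(** The steps before B and after qB produce at least m roots of u_n(x; .),
    which is all that the rule of signs permits; a root between B and qB would
    be one more. *)
Lemma gap_no_root n B i x c : B < 0 -> 0 < x < 1 -> (i <= n)%N ->
    ((0 < i)%N -> (zer n (q * B))`_i.-1 < x) ->
    ((i < n)%N -> x < (zer n B)`_i) ->
  B < c < q * B -> ~~ root (param_poly n x) c.
Proof.
move=> B0 /andP[x0 x1] i_n lo hi /andP[Bc cqB]; apply/negP => rc.
have qB0 := shift_lt0 q_gt0 B0.
have [m [mn mlo mhi]] := exists_level q n x1.
have [k1 hk1] := all_zeros_upto n B0 x0.
have [k2 hk2] := few_zeros_upto qB0 mn mlo.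
have qk1 : q ^+ k1 * (q ^- k1 * B) = B by rewrite mulrA divff ?mul1r// expf_neq0.
have B10 : q ^- k1 * B < 0 by rewrite pmulr_rlt0// invr_gt0 exprn_gt0.
have [s1 [us1 rs1 bs1 hs1]] := lattice_roots n x k1 B10.
have [s2 [us2 rs2 bs2 hs2]] := lattice_roots n x k2 qB0.
rewrite qk1 in bs1 hs1.
have far0 : q ^+ k2 * (q * B) < 0 by rewrite pmulr_rlt0// exprn_gt0.
have upB : (zeros_upto n B x <= i)%N.
  rewrite leqNgt; apply/negP => h; have := nth_count_le 0 (zer_sorted n B0) h.
  apply/negP; rewrite -ltNge hi// (leq_trans h)//.
  by rewrite -{2}(size_zer q_gt0 q_lt1 n B0) count_size.
have upqB : (i <= zeros_upto n (q * B) x)%N.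
  rewrite leqNgt; apply/negP => h.
  have i0 : (0 < i)%N by exact: leq_trans h.
  have := @nth_count_gt _ _ x 0 _ i.-1 (zer_sorted n qB0).
  rewrite size_zer// -ltnS !prednK// h i_n => /(_ isT).
  by apply/negP; rewrite -leNgt ltW// lo.
have : (size (c :: s1 ++ s2) <= m)%N.
  apply: (@size_param_roots _ q q_gt0 q_lt1 n m x) => //.
  - rewrite /= mem_cat cat_uniq us1 us2 negb_or andbT.
    apply/and3P; split.
    + apply/andP; split; apply/negP.
        by move=> /(allP bs1)/andP[_ h]; have := lt_trans Bc h; rewrite ltxx.
      by move=> /(allP bs2)/andP[h _]; have := le_lt_trans h cqB; rewrite ltxx.
    + by [].
    + apply/hasPn => d /(allP bs2) /andP[h1 _].
      apply/negP => /(allP bs1) /andP[_ h2].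
      by have := lt_trans (lt_trans Bc cqB) (le_lt_trans h1 h2); rewrite ltxx.
  - rewrite /= (lt_trans cqB)//= all_cat; apply/andP; split.
      by apply: sub_all bs1 => d /andP[_ h]; exact: lt_trans B0.
    by apply: sub_all bs2 => d /andP[_ h]; exact: lt_trans far0.
  - by rewrite /= rc all_cat rs1.
rewrite /= size_cat; apply/negP; rewrite -ltnNge ltnS.
rewrite -(leq_add2l (n - m)) subnK// addnA -[leqLHS]hk1.
rewrite (leq_trans hs1)// addnAC leq_add2r (leq_trans upB)// (leq_trans upqB)//.
by rewrite (leq_trans hs2)// leq_add2r.
Qed.

Lemma gap_sign n B i x c : B < 0 -> 0 < x < 1 -> (i <= n)%N ->
    ((0 < i)%N -> (zer n (q * B))`_i.-1 < x) ->
    ((i < n)%N -> x < (zer n B)`_i) ->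
  B <= c <= q * B -> 0 < (-1) ^+ i * (bes n c).[x].
Proof.
move=> B0 x01 i_n lo hi /andP[Bc cqB].
have sgnB : 0 < (-1) ^+ i * (bes n B).[x].
  apply: bes_sign => // i0; apply: lt_trans (lo i0).
  have i1 : (i.-1 < n)%N by rewrite prednK.
  by have [] := zer_shift q_gt0 q_lt1 B0 i1.
have sgnqB : 0 < (-1) ^+ i * (bes n (q * B)).[x].
  apply: bes_sign => //; first exact: shift_lt0.
  move=> i1; apply: lt_trans (hi i1) _.
  by have [] := zer_shift q_gt0 q_lt1 B0 i1.
move: Bc; rewrite le_eqVlt => /predU1P[<-//|Bc].
move: cqB; rewrite le_eqVlt => /predU1P[->//|cqB].
have cP : ~~ root (param_poly n x) c by apply: (@gap_no_root n B i) => //; rewrite Bc.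
rewrite lt_neqAle eq_sym mulf_neq0 ?signr_eq0//=; last first.
  by rewrite -horner_param_poly.
rewrite leNgt; apply/negP => h.
have [] := @poly_ivtoo _ (param_poly n x) B c (ltW Bc).
  rewrite !horner_param_poly// -(pmulr_rlt0 _ sgnB).
  have b0 : (bes n B).[x] != 0.
    by apply: contraTneq sgnB => ->; rewrite mulr0 ltxx.
  rewrite [ltLHS](_ : _ =
    (bes n B).[x] ^+ 2 * ((-1) ^+ i * (bes n c).[x])); last by ring.
  by rewrite pmulr_rlt0// exprn_even_gt0.
move=> d; rewrite in_itv /= => /andP[Bd dc]; apply/negP.
by apply: (@gap_no_root n B i) => //; rewrite Bd (lt_trans dc).
Qed.

(** The gaps (lo j, hi j) between the zeros of u_n(.; qB) and the next zeros of
    u_n(.; B) carry known alternating signs of u_n(.; c). Their midpoints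
    separate the zeros of u_n(.; c), and these zeros avoid the gaps. *)
Lemma zer_monotone n B c i : B < 0 -> B <= c <= q * B -> (i < n)%N ->
  (zer n B)`_i <= (zer n c)`_i <= (zer n (q * B))`_i.
Proof.
move=> B0 Bcq i_n; have qB0 := shift_lt0 q_gt0 B0.
have c0 : c < 0 by have /andP[_ /le_lt_trans->] := Bcq.
pose lo j := if j is j'.+1 then (zer n (q * B))`_j' else 0.
pose hi j := if (j < n)%N then (zer n B)`_j else 1.
have lo_hi j : (j <= n)%N -> lo j < hi j.
  rewrite /hi /lo; case: j => [|j] jn; case: ltnP => h.
  - by have /andP[] := zer_itv q_gt0 q_lt1 B0 h.
  - exact: ltr01.
  - by have [_ /(_ h)] := zer_shift q_gt0 q_lt1 B0 jn.
  - by have /andP[] := zer_itv q_gt0 q_lt1 qB0 jn.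
have hi_lo j : (j < n)%N -> hi j < lo j.+1.
  by move=> jn; rewrite /hi /lo jn; have [] := zer_shift q_gt0 q_lt1 B0 jn.
have gap j x : (j <= n)%N -> lo j < x -> x < hi j ->
    0 < (-1) ^+ j * (bes n c).[x].
  move=> jn lx xh; apply: (gap_sign B0) => //.
  - apply/andP; split.
      apply: le_lt_trans lx; case: j jn {xh} => [//|j] jn /=.
      by have /andP[/ltW] := zer_itv q_gt0 q_lt1 qB0 jn.
    apply: lt_le_trans xh _; rewrite /hi; case: ltnP => // h.
    by have /andP[_ /ltW] := zer_itv q_gt0 q_lt1 B0 h.
  - by case: j jn lx {xh}.
  - by move=> h; move: xh; rewrite /hi h.
pose y j := (lo j + hi j) / 2.
have y_gap j : (j <= n)%N -> lo j < y j < hi j.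
  by move=> /lo_hi h; rewrite /y !(midf_lt h).
have := zeros_interlace q_gt0 (zerP q_gt0 q_lt1 n c0) (y := y).
case/(_ _ _ i i_n)/andP.
- move=> j jn; have /andP[_ h1] := y_gap j (ltnW jn); have /andP[h2 _] := y_gap _ jn.
  exact: lt_trans h1 (lt_trans (hi_lo _ jn) h2).
- by move=> j jn; have /andP[h1 h2] := y_gap j jn; exact: gap.
move=> z_lo z_hi.
have /andP[h1 _] := y_gap i (ltnW i_n); have /andP[_ h2] := y_gap _ i_n.
have not_gap j : (j <= n)%N ->
    lo j < (zer n c)`_i -> (zer n c)`_i < hi j -> False.
  by move=> jn l h; have := gap _ _ jn l h; rewrite zer_root// mulr0 ltxx.
apply/andP; split; rewrite leNgt; apply/negP => h.
  by apply: (not_gap i); [exact: ltnW | exact: lt_trans z_lo | rewrite /hi i_n].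
by apply: (not_gap i.+1) => //; exact: lt_trans h2.
Qed.

Lemma q_besselE n b : q_bessel n b q = bes n (b * q ^+ n).
Proof. by []. Qed.

Lemma zeros_in_bes n B (K : set R) : B < 0 ->
  (forall z, z \in zer n B -> K z) -> zeros_in K (bes n B).
Proof.
move=> B0 hK z; have [_ _ _ pE] := zerP q_gt0 q_lt1 n B0.
rewrite pE map_polyZ /= rootE hornerZ mulf_eq0 => /orP[|].
  rewrite fmorph_eq0 lead_coef_eq0 -size_poly_eq0 size_bes//.
rewrite rmorph_prod /= horner_prod prodf_seq_eq0 => /hasP[w ws /=].
rewrite map_polyXsubC hornerXsubC subr_eq0 => /eqP ->.
by exists w => //; exact: hK.
Qed.

Lemma polys_lmesh_bes n B : B < 0 -> polys_lmesh n q `]0, 1[%classic (bes n B).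
Proof.
move=> B0; have [ss srt s01 pE] := zerP q_gt0 q_lt1 n B0.
split=> [||_]; first exact: size_bes.
  by apply: zeros_in_bes => // z /(allP s01); rewrite /= in_itv.
rewrite /lmesh size_bes//=.
rewrite big_nat_cond.
elim/big_ind: _ => // [u v hu hv|j]; first by rewrite gt_max hu.
rewrite andbT => /andP[j0 jn].
have j1 : (j.-1.+1 < n)%N by rewrite prednK.
have /andP[z0 _] := zer_itv q_gt0 q_lt1 B0 j1.
rewrite /lambda -/(zer n B) /= -{2}(prednK j0) ltr_pdivrMr//.
exact: zer_mesh.
Qed.

Lemma preceq_bes n B c : B < 0 -> c < 0 ->
    (forall i, (i < n)%N -> (zer n B)`_i <= (zer n c)`_i) ->
    (forall i, (i.+1 < n)%N -> (zer n c)`_i <= (zer n B)`_i.+1) ->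
  preceq (bes n B) (bes n c).
Proof.
move=> B0 c0 h1 h2; rewrite /preceq !size_bes//=; split=> //.
- by split; [rewrite -size_poly_gt0 size_bes | exact: zeros_in_bes].
- by split; [rewrite -size_poly_gt0 size_bes | exact: zeros_in_bes].
- by move=> j /andP[j0 jn]; apply: h1; rewrite prednK.
- move=> j /andP[j0 jn]; rewrite /lambda -/(zer n B) -/(zer n c) /= -{2}(prednK j0).
  by apply: h2; rewrite prednK.
Qed.

Lemma preceq_scaled n B t : B < 0 -> q ^+ 2 < t -> t < 1 ->
  preceq (bes n B) (bes n (t * B)).
Proof.
move=> B0 q2t t1; have qB0 := shift_lt0 q_gt0 B0.
have t0 : 0 < t by apply: lt_trans q2t; rewrite exprn_gt0.
have tB0 : t * B < 0 by rewrite pmulr_rlt0.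
have [qt|tq] := leP q t.
  have BtB : B <= t * B <= q * B.
    by rewrite ler_nMl// (ltW t1) ler_nM2r.
  apply: preceq_bes => // i i_n.
    by have /andP[] := zer_monotone B0 BtB i_n.
  have /andP[_ h] := zer_monotone B0 BtB (ltnW i_n); apply: (le_trans h).
  by have [_ /(_ i_n)/ltW] := zer_shift q_gt0 q_lt1 B0 (ltnW i_n).
have qtq : q * B <= t * B <= q * (q * B).
  by rewrite mulrA -expr2 !ler_nM2r// !ltW.
apply: preceq_bes => // i i_n.
  have /andP[h _] := zer_monotone qB0 qtq i_n; apply: le_trans h.
  by have [/ltW] := zer_shift q_gt0 q_lt1 B0 i_n.
have /andP[_ h] := zer_monotone qB0 qtq (ltnW i_n); apply: (le_trans h).
exact/ltW/zer_shift2.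
Qed.

End ParameterMonotonicity.

Unset Implicit Arguments.
Set Strict Implicit.

Theorem theorem3p6 (R : realType) (q : R) (n : nat) (b : R)
  (q_gt0 : 0 < q) (q_lt1 : q < 1) (n_ge1 : (1 <= n)%N) (b_lt0 : b < 0) :
  polys_lmesh n q `]0, 1[%classic (q_bessel n b q) /\
  (forall t : R, q ^+ 2 < t -> t < 1 ->
     preceq (q_bessel n b q) (q_bessel n (t * b) q)).
Proof.
have B0 : b * q ^+ n < 0 by rewrite nmulr_rlt0// exprn_gt0.
rewrite q_besselE; split; first exact: polys_lmesh_bes.
move=> t q2t t1; rewrite q_besselE -mulrA; exact: preceq_scaled.
Qed.
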